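(* For every real $\epsilon>0$ and all natural numbers $d,k\ge 1$ there is some $r=r(\epsilon,d,k)$ such that for every finite group $G$ with $\mathrm{Pr}_{G,w_k}(1)\ge \epsilon$ there is a characteristic subgroup $N$ of $G$ which is nilpotent of class less than $k$ and such that every $d$-generator subgroup of $G/N$ has order at most $r$.
   Context: The left normed commutator words are defined inductively by $w_1=x_1$ and $w_{k+1}=[w_k,x_{k+1}]$, so $w_k(x_1,\ldots,x_k)=[x_1,\ldots,x_k]$. For a finite group $G$, $$\mathrm{Pr}_{G,w_k}(1)=\frac{|\{(g_1,\ldots,g_k)\in G^k : w_k(g_1,\ldots,g_k)=1\}|}{|G|^k}.$$ A $d$-generator subgroup is a subgroup generated by $d$ elements. Nilpotent of class $0$ means trivial. *)

(* Defs.v *)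
From mathcomp Require Import all_boot all_order all_algebra all_fingroup all_solvable.
From mathcomp Require Import reals.

Set Implicit Arguments.
Unset Strict Implicit.
Unset Printing Implicit Defensive.

Import Order.TTheory GRing.Theory Num.Theory GroupScope.

(* [lnorm_comm [:: x1; ...; xk]] is w_k(x1, ..., xk) for k >= 1, since
   w_{j+1} = [w_j, x_{j+1}] is a left fold started at w_1 = x1.  The value 1
   on the empty sequence is a junk value.  Here [~ x, y] = x^-1 y^-1 x y. *)
Definition lnorm_comm (gT : finGroupType) (s : seq gT) : gT :=
  if s is x :: s' then foldl (fun w y => [~ w, y]) x s' else 1.

Definition lnorm_comm_solutions (gT : finGroupType) (G : {group gT}) (k : nat) :
    {set k.-tuple gT} :=
  [set g : k.-tuple gT | all [in G] g & lnorm_comm g == 1].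

Definition Pr_lnorm_comm1 (R : realType) (gT : finGroupType) (G : {group gT})
    (k : nat) : R :=
  (#|lnorm_comm_solutions G k|%:R / (#|G| ^ k)%N%:R)%R.

(* The d generators may be repeated or trivial. *)
Definition generated_by_d (gT : finGroupType) (d : nat) (H : {group gT}) : Prop :=
  exists t : d.-tuple gT, H :=: <<[set x in t]>>.

(* Both conjuncts are needed: [nil_class A] is #|A| when A is not nilpotent, so
   the inequality alone could hold for a non-nilpotent group. *)
Definition nilpotent_class_lt (gT : finGroupType) (k : nat) (A : {group gT}) : bool :=
  nilpotent A && (nil_class A < k)%N.

(* Main.v *)
Require Import Defs.
From mathcomp Require Import all_boot all_order all_algebra all_fingroup all_solvable.
From mathcomp Require Import reals.
From mathcomp Require Import zify.
Set Implicit Arguments.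
Unset Strict Implicit.
Unset Printing Implicit Defensive.
Import Order.TTheory GRing.Theory Num.Theory GroupScope.

(** The subgroup N is the intersection of all subgroups of G of index at most m,
    where m = 2^(k-1) M and M >= 1/eps; call it the m-index core of G.

    The core is characteristic, and it is large from the viewpoint of finitely
    generated subgroups ([index_index_core_le]).  Indeed a subgroup L of a group
    H with generators t_1, ..., t_d is determined by the action of the t_i on the
    cosets of L, so H has boundedly many subgroups of index at most m
    ([card_subgroups_index_le]) and their intersection has bounded index.  When
    H lies in G, that intersection lies in N, because a subgroup of index at most
    m in G meets H in a subgroup of index at most m in H.

    Nilpotency of N is where the probability enters ([lcn_sub_of_lnorm_comm]).
    If [w_k(x), y] = 1 holds for a proportion at least 1/M of all (x, y), then by
    averaging, for at least 1/(2M) of the x, the centraliser of u = w_k(x) has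
    index at most 2M in G.  For such x this centraliser contains N, that is,
    u lies in C_G(N).  So w_k takes values in the normal subgroup C_G(N) with
    proportion at least 1/(2M), and by induction, applied modulo C_G(N), the k-th term of
    the lower central series of N lies in C_G(N).  Hence the next term is
    trivial.  For the induction to go through, the statement is relative to a
    normal subgroup K, with C_G(N) replaced by the centraliser of N modulo K.
    Each step doubles M, which is the origin of the factor 2^(k-1). *)

(** * Counting subgroups of bounded index *)

Section CosetTable.

Variables (gT : finGroupType) (H : {group gT}) (d m : nat) (t : d.-tuple gT).

(** Cosets of different subgroups L of index at most m have to be compared, so
    they are all numbered in one type.  It is 'I_m.+1 and not 'I_m only because
    [inord] needs a nonempty target. *)
Definition coset_number (L A : {set gT}) : 'I_m.+1 :=
  inord (index A (enum (rcosets L H))).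

(** The Todd-Coxeter coset table of L: the action of the generators on the
    numbered cosets, and the number of the coset L itself. *)
Definition coset_table (L : {group gT}) :
    {ffun 'I_d * 'I_m.+1 -> 'I_m.+1} * 'I_m.+1 :=
  ([ffun p : 'I_d * 'I_m.+1 =>
      coset_number L (nth set0 (enum (rcosets L H)) p.2 :* tnth t p.1)],
   coset_number L L).

Lemma index_rcoset (L : {group gT}) A :
  #|H : L| <= m -> A \in rcosets L H -> index A (enum (rcosets L H)) < m.+1.
Proof.
by move=> leLm LA; rewrite ltnS (leq_trans _ leLm) // /indexg cardE ltnW //
  index_mem mem_enum.
Qed.

Lemma coset_number_inj (L : {group gT}) :
  #|H : L| <= m -> {in rcosets L H &, injective (coset_number L)}.
Proof.
move=> leLm A B LA LB /(congr1 val).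
rewrite /= !inordK ?index_rcoset // => eqAB.
by rewrite -(nth_index set0 (s := enum (rcosets L H)) (x := A)) ?mem_enum //
  eqAB nth_index ?mem_enum.
Qed.

Lemma coset_tableM (L : {group gT}) x (i : 'I_d) :
    #|H : L| <= m -> x \in H ->
  coset_number L (L :* (x * tnth t i)) =
  (coset_table L).1 (i, coset_number L (L :* x)).
Proof.
move=> leLm Hx; rewrite ffunE /=; congr (coset_number _ _).
have Lx : L :* x \in rcosets L H by apply/rcosetsP; exists x.
by rewrite inordK ?index_rcoset // nth_index ?mem_enum // rcosetM.
Qed.

Hypothesis genH : H :=: <<[set x in t]>>.

(** From the table one reads off the number of the coset of any product of
    generators, hence of any element x of H, because H is finite and so generated
    by the t_i as a monoid.  And x lies in L exactly when the coset of x has the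
    same number as L. *)
Lemma coset_table_inj :
  {in [set L : {group gT} | L \subset H & #|H : L| <= m] &,
    injective coset_table}.
Proof.
move=> L1 L2; rewrite !inE => /andP[sL1H leL1] /andP[sL2H leL2] eqT.
have eq_num x :
    x \in H -> coset_number L1 (L1 :* x) = coset_number L2 (L2 :* x).
  rewrite {1}genH => /gen_prodgP[n [c tc ->]] {x}.
  have mem_c i : c i \in H by rewrite genH mem_gen.
  elim: n => [|n IHn] in c tc mem_c *.
    by rewrite big_ord0 !rcoset1; case: eqT.
  rewrite big_ord_recr /=.
  have /tnthP[i ->] : c ord_max \in t by have:= tc ord_max; rewrite inE.
  by rewrite !coset_tableM ?group_prod // eqT IHn.
have memE (L : {group gT}) x : #|H : L| <= m -> x \in H ->
    (x \in L) = (coset_number L (L :* x) == coset_number L (L :* 1)).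
  move=> leL Hx; apply/idP/eqP => [Lx | /coset_number_inj eqLx].
    by rewrite rcoset1 rcoset_id.
  by rewrite -(rcoset1 L) -eqLx ?rcoset_refl //; apply/rcosetsP;
    [exists x | exists 1].
apply/val_inj/setP => x /=; have [Hx | H'x] := boolP (x \in H); last first.
  by rewrite (contraNF (subsetP sL1H x)) ?(contraNF (subsetP sL2H x)).
by rewrite (memE L1) // (memE L2) // !eq_num.
Qed.

Lemma card_subgroups_index_le :
  #|[set L : {group gT} | L \subset H & #|H : L| <= m]|
    <= m.+1 ^ (d * m.+1) * m.+1.
Proof.
rewrite -(card_in_imset coset_table_inj) (leq_trans (max_card _)) //.
by rewrite card_prod card_ffun card_prod !card_ord.
Qed.

End CosetTable.

(** * The intersection of the subgroups of bounded index *)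

Section IndexCore.

Variables (gT : finGroupType) (m : nat).
Implicit Types G H K L : {group gT}.

Definition index_core G : {group gT} :=
  (G :&: \bigcap_(L : {group gT} | (L \subset G) && (#|G : L| <= m)) L)%G.

Lemma index_core_sub G : index_core G \subset G.
Proof. exact: subsetIl. Qed.

Lemma index_core_min G L :
  L \subset G -> #|G : L| <= m -> index_core G \subset L.
Proof.
by move=> sLG leL; rewrite subIset // orbC (bigcap_min L) // sLG.
Qed.

Lemma index_core_char G : index_core G \char G.
Proof.
apply/charP; split=> [|f injf fG]; first exact: index_core_sub.
apply/eqP; rewrite eqEcard card_injm ?index_core_sub // leqnn andbT.
have sfG: f @* index_core G \subset G.
  by apply: subset_trans (morphimS f (index_core_sub G)) _; rewrite fG.
rewrite subsetI sfG.
apply/bigcapsP=> L /andP[sLG leL]; rewrite sub_morphim_pre ?index_core_sub //.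
apply: index_core_min; first exact: subsetIl.
have preG : f @*^-1 G = G.
  by have := morphimGK (subsetIl _ _) (subxx G) (f := f); rewrite fG.
by rewrite -{1}preG index_morphpre ?fG.
Qed.

Lemma index_setI_le H (K L : {group gT}) :
  #|H : K :&: L| <= #|H : K| * #|H : L|.
Proof.
rewrite -(indexgI H (K :&: L)%G) /= setIA.
rewrite -(Lagrange_index (subsetIl H K) (subsetIl _ L)).
by rewrite !indexgI leq_mul // subset_leq_card // imsetS // subsetIl.
Qed.

Lemma index_bigcap_le H (S : {set {group gT}}) :
    (forall L, L \in S -> #|H : L| <= m) ->
  #|H : \bigcap_(L in S) L| <= m ^ #|S|.
Proof.
move=> leS; rewrite -prod_nat_const.
(* [bounded] retains a group structure on the partial intersections. *)
pose bounded (A : {set gT}) n := exists2 L : {group gT}, A = L & #|H : L| <= n.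
suffices [L -> //]: bounded (\bigcap_(L in S) L) (\prod_(L in S) m)%N.
apply: (big_ind2 bounded) => [|A1 n1 A2 n2 [L1 -> le1] [L2 -> le2]|L SL].
- by exists [set: gT]%G; rewrite // -indexgI setIT indexgg.
- exists (L1 :&: L2)%G => //.
  by rewrite (leq_trans (index_setI_le _ _ _)) ?leq_mul.
- by exists L => //; apply: leS.
Qed.

(** The core of G contains the intersection of the subgroups of index at most m
    of H, and the number of those is bounded in terms of d and m. *)
Lemma index_index_core_le G H d (t : d.-tuple gT) :
    0 < m -> H \subset G -> H :=: <<[set x in t]>> ->
  #|H : index_core G| <= m ^ (m.+1 ^ (d * m.+1) * m.+1).
Proof.
move=> m_gt0 sHG genH.
pose S := [set L : {group gT} | L \subset H & #|H : L| <= m].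
have leS : #|H : \bigcap_(L in S) L| <= m ^ #|S|.
  by apply: index_bigcap_le => L; rewrite inE => /andP[].
apply: leq_trans (leq_trans leS _); last first.
  by rewrite leq_pexp2l // (card_subgroups_index_le _ genH).
rewrite dvdn_leq // indexgS //.
apply/subsetP=> x /bigcapP Sx.
have Hx: x \in H by apply: Sx; rewrite inE subxx indexgg.
rewrite inE (subsetP sHG) //=.
apply/bigcapP=> L /= /andP[sLG leL].
have: x \in (H :&: L)%G.
  apply: Sx; rewrite inE subsetIl indexgI (leq_trans _ leL) //.
  by rewrite subset_leq_card // imsetS.
by case/setIP.
Qed.

End IndexCore.

(** Lift generators of H to G: then H is the image of the d-generator subgroup S
    of G that they generate, and its order is the index of the core in S. *)
Lemma card_quotient_index_core_le (gT : finGroupType) (G : {group gT}) m d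
    (H : {group coset_of (index_core m G)}) :
    0 < m -> H \subset G / index_core m G -> generated_by_d d H ->
  #|H| <= m ^ (m.+1 ^ (d * m.+1) * m.+1).
Proof.
set N := index_core m G => m_gt0 sHG [t genH].
have nNG : G \subset 'N(N) by exact/char_norm/index_core_char.
have lift_t i : exists2 x, x \in G & tnth t i = coset N x.
  have /(subsetP sHG)/morphimP[x _ Gx ->]: tnth t i \in H; last by exists x.
  by rewrite genH mem_gen // inE mem_tnth.
have [s Gs def_t]: exists2 s : d.-tuple gT,
    all [in G] s & t = map_tuple (coset N) s.
  have [x Gx def_x] := fin_all_exists2 lift_t.
  exists [tuple x i | i < d]; first by apply/allP=> _ /codomP[i ->].
  by apply: eq_from_tnth => i; rewrite tnth_map tnth_mktuple.
have sSG : <<[set x in s]>> \subset G.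
  by rewrite gen_subG; apply/subsetP=> x; rewrite inE => /(allP Gs).
have nNs : [set x in s] \subset 'N(N).
  exact: subset_trans (subset_gen _) (subset_trans sSG nNG).
have defH : H :=: <<[set x in s]>> / N.
  rewrite genH def_t quotient_gen //; congr <<_>>; apply/setP=> y.
  rewrite inE; apply/mapP/morphimP => [[x sx ->]|[x nx sx ->]]; exists x => //.
  - by rewrite (subsetP nNs) // inE.
  - by rewrite inE.
  - by rewrite inE in sx.
rewrite defH card_quotient ?(subset_trans sSG) //.
exact: (index_index_core_le (t := s) m_gt0 sSG).
Qed.

(** The indices with f i < n / (2 M) contribute at most half of the sum, so the
    other half comes from the indices that are counted on the right. *)
Lemma leq_sum_markov (I : finType) (X : {set I}) (f : I -> nat) n M :
    0 < n -> (forall i, i \in X -> f i <= n) ->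
    #|X| * n <= M * \sum_(i in X) f i ->
  #|X| <= 2 * M * #|[set i in X | n <= 2 * M * f i]|.
Proof.
move=> n_gt0 le_fn le_avg; set A := [set i in X | _].
have sAX : A \subset X by apply/subsetP=> i; rewrite inE => /andP[].
have leA : \sum_(i in A) f i <= #|A| * n.
  by rewrite -sum_nat_const leq_sum // => i /(subsetP sAX)/le_fn.
have leD : 2 * M * \sum_(i in X :\: A) f i <= #|X| * n.
  apply: leq_trans (_ : #|X :\: A| * n <= _); last first.
    by rewrite leq_mul2r subset_leq_card ?subsetDl ?orbT.
  rewrite big_distrr -sum_nat_const leq_sum // => i.
  by rewrite !inE; case/andP=> + Xi; rewrite Xi -ltnNge => /ltnW.
rewrite (big_setID A) (setIidPr sAX) /= in le_avg.
rewrite -(leq_pmul2r n_gt0).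
move: leA leD le_avg; set a := \sum_(i in A) _; set b := \sum_(i in _) _.
nia.
Qed.

(** * Left normed commutators modulo a normal subgroup *)

Section Commutators.

Variables (gT : finGroupType) (G : {group gT}).
Implicit Types (K N : {group gT}) (A : {set gT}).

(** The centraliser in G of A modulo K.  It serves twice: for A = {u}, its order
    counts the y with [u, y] in K; for A = N, it is the normal subgroup modulo
    which the induction continues. *)
Definition cent_mod K A : {group gT} := (G :&: coset K @*^-1 'C(A / K))%G.

Lemma cent_modP K A y :
    K <| G -> A \subset G -> y \in G ->
  reflect (forall a, a \in A -> [~ a, y] \in K) (y \in cent_mod K A).
Proof.
move=> /normal_norm nKG sAG Gy; have nKA := subset_trans sAG nKG.
have nKy := subsetP nKG y Gy.
rewrite in_setI Gy /= in_setI nKy inE /=.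
apply: (iffP centP) => [cAy a Aa | cAy _ /morphimP[a nKa Aa ->]].
  have nKa := subsetP nKA a Aa.
  apply: coset_idr; rewrite ?groupR // morphR //.
  by apply/eqP/commgP/commute_sym/cAy; rewrite mem_morphim.
by apply/commute_sym/commgP/eqP; rewrite -morphR //= coset_id ?cAy.
Qed.

Lemma cent_mod_normal K N : K <| G -> N <| G -> cent_mod K N <| G.
Proof.
move=> /normal_norm nKG /normal_norm nNG.
rewrite /normal subsetIl normsI ?normG //.
by rewrite norm_quotient_pre // norms_cent // quotient_norms.
Qed.

Definition lnorm_comm_preim k K : {set k.-tuple gT} :=
  [set g : k.-tuple gT | all [in G] g & lnorm_comm g \in K].

Lemma lnorm_comm_rcons s (y : gT) :
  0 < size s -> lnorm_comm (rcons s y) = [~ lnorm_comm s, y].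
Proof. by case: s => // x s _; rewrite /= foldl_rcons. Qed.

Lemma lnorm_comm_in s : all [in G] s -> lnorm_comm s \in G.
Proof.
elim/last_ind: s => [|[|x s] y IHs]; first by rewrite group1.
  by rewrite /= andbT.
rewrite all_rcons => /andP[Gy /IHs Gs].
by rewrite lnorm_comm_rcons ?groupR.
Qed.

Lemma card_tuples_rcons k (P : pred (seq gT)) :
  #|[set g : k.+1.-tuple gT | all [in G] g & P g]| =
  \sum_(g : k.-tuple gT | all [in G] g) #|[set y in G | P (rcons g y)]|.
Proof.
under [RHS]eq_bigr do rewrite -sum1_card.
rewrite -sum1_card pair_big_dep /=.
pose snoc (p : k.-tuple gT * gT) := [tuple of rcons p.1 p.2].
rewrite (reindex snoc) /=.
  by apply: eq_bigl => -[g y]; rewrite !inE /= all_rcons andbAC andbC andbA.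
apply: onW_bij.
pose unsnoc (t : k.+1.-tuple gT) : k.-tuple gT * gT :=
  ([tuple of belast (thead t) (behead t)], last (thead t) (behead t)).
have unsnocK : cancel unsnoc snoc.
  by move=> t; apply: val_inj; rewrite /= -lastI [in RHS](tuple_eta t).
exists unsnoc => // -[g y].
have /(congr1 val)/= := unsnocK (snoc (g, y)).
by case/rcons_inj=> eq_g eq_y; congr (_, _); first apply: val_inj.
Qed.

Lemma card_tuples_in k :
  #|[set g : k.-tuple gT | all [in G] g]| = (#|G| ^ k)%N.
Proof.
elim: k => [|k IHk].
  rewrite expn0 -(expn0 #|gT|) -card_tuple -cardsT; congr #|pred_of_set _|.
  by apply/setP=> t; rewrite !inE tuple0.
transitivity #|[set g : k.+1.-tuple gT | all [in G] g & predT (tval g)]|.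
  by apply: eq_card => g; rewrite !inE andbT.
rewrite (card_tuples_rcons _ predT) expnSr -IHk -sum_nat_const.
apply: eq_big => [g | g _]; first by rewrite inE.
by apply: eq_card => y; rewrite inE andbT.
Qed.

(** The number of y with [w(g), y] in K is the order of the centraliser of w(g)
    modulo K, so the hypothesis bounds from below the average of these orders
    over all g. *)
Lemma many_lnorm_comm_large_cent k M K : K <| G ->
    #|G| ^ k.+2 <= M * #|lnorm_comm_preim k.+2 K| ->
  #|G| ^ k.+1 <= 2 * M * #|[set g : k.+1.-tuple gT | all [in G] g &
                     #|G| <= 2 * M * #|cent_mod K [set lnorm_comm g]| ]|.
Proof.
move=> nKG leG; rewrite -(card_tuples_in k.+1).
pose f (g : k.+1.-tuple gT) := #|cent_mod K [set lnorm_comm g]|.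
have sumf : #|lnorm_comm_preim k.+2 K| =
    \sum_(g in [set g : k.+1.-tuple gT | all [in G] g]) f g.
  rewrite [LHS](card_tuples_rcons _ (fun s => lnorm_comm s \in K)).
  apply: eq_big => [g | g Gg]; first by rewrite inE.
  apply: eq_card => y; rewrite inE lnorm_comm_rcons ?size_tuple //.
  have [Gy | /negPf G'y] := boolP (y \in G); last by rewrite inE G'y.
  apply/idP/cent_modP => //; first by rewrite sub1set lnorm_comm_in.
    by move=> Kwy _ /set1P->.
  by apply; apply: set11.
apply: leq_trans (leq_sum_markov (f := f) (M := M) (cardG_gt0 G) _ _) _.
- by move=> g _; rewrite subset_leq_card ?subsetIl.
- by rewrite -sumf card_tuples_in -expnSr.
- rewrite leq_mul2l; apply/orP; right.
  by apply/subset_leq_card/subsetP => g; rewrite !inE.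
Qed.

End Commutators.

(** * Nilpotency and the main theorem *)

(** For k = 0 the hypothesis says that K has index at most M.  In the inductive
    step, N centralises w(g) modulo K whenever that centraliser has index at most
    2 M; so w(g) lies in the centraliser K' of N modulo K for many g, the
    induction hypothesis gives 'L_k.+1(N) \subset K', and [~: K', N] \subset K. *)
Lemma lcn_sub_of_lnorm_comm (gT : finGroupType) (G N : {group gT}) m :
    N <| G ->
    (forall L : {group gT}, L \subset G -> #|G : L| <= m -> N \subset L) ->
  forall k M (K : {group gT}), 2 ^ k * M <= m -> K <| G ->
    #|G| ^ k.+1 <= M * #|lnorm_comm_preim G k.+1 K| ->
  'L_k.+1(N) \subset K.
Proof.
move=> nNG minN; elim=> [|k IHk] M K leM nKG leG.
  apply: minN; first exact: normal_sub.
  have leK : #|lnorm_comm_preim G 1 K| <= #|K|.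
    have val_tuple1 (t : 1.-tuple gT) : tval t = [:: thead t].
      by case: t => [[|x [|]] //= sz1]; rewrite /thead (tnth_nth x).
    rewrite -(card_in_imset (f := @thead 0 gT)).
      apply/subset_leq_card/subsetP => _ /imsetP[t + ->].
      by rewrite inE (val_tuple1 t) /= => /andP[].
    move=> t1 t2 _ _ eq12; apply: val_inj.
    by rewrite /= (val_tuple1 t1) (val_tuple1 t2) eq12.
  rewrite (leq_trans _ leM) // mul1n -(leq_pmul2l (cardG_gt0 K)).
  by rewrite Lagrange ?normal_sub // (leq_trans leG) // mulnC leq_mul2r leK orbT.
have nK'G : cent_mod G K N <| G by apply: cent_mod_normal.
have sLK' : 'L_k.+1(N) \subset cent_mod G K N.
  apply: (IHk (2 * M)%N) => //; first by rewrite mulnA -expnSr.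
  apply: leq_trans (many_lnorm_comm_large_cent nKG leG) _.
  rewrite leq_mul2l; apply/orP; right.
  apply/subset_leq_card/subsetP => g; rewrite inE => /andP[Gg leg].
  have Gw := lnorm_comm_in Gg.
  rewrite inE Gg /=; apply/cent_modP => //; first exact: normal_sub.
  move=> n Nn; rewrite -groupV invg_comm.
  have Gn := subsetP (normal_sub nNG) n Nn.
  have sNcent : N \subset cent_mod G K [set lnorm_comm g].
    apply: minN; first exact: subsetIl.
    have leM2 : 2 * M <= m.
      rewrite (leq_trans _ leM) // expnS -mulnA leq_mul2l.
      by rewrite leq_pmull ?expn_gt0.
    rewrite (leq_trans _ leM2) //.
    rewrite -(leq_pmul2l (cardG_gt0 (cent_mod G K [set lnorm_comm g]))).
    by rewrite Lagrange ?subsetIl // mulnC.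
  have /cent_modP := subsetP sNcent n Nn.
  by apply; rewrite ?sub1set ?set11.
rewrite lcnSn gen_subG; apply/subsetP=> _ /imset2P[x n Lx Nn ->].
have K'x := subsetP sLK' x Lx; have Gx := subsetP (normal_sub nK'G) x K'x.
by rewrite -groupV invg_comm; apply: (cent_modP nKG (normal_sub nNG) Gx _).
Qed.

Lemma nilpotent_index_core (gT : finGroupType) (G : {group gT}) k M :
    #|G| ^ k.+1 <= M * #|lnorm_comm_solutions G k.+1| ->
  nilpotent_class_lt k.+1 (index_core (2 ^ k * M) G).
Proof.
move=> leG; set N := index_core _ G.
have sub1 : 'L_k.+1(N) \subset [1 gT].
  apply: (@lcn_sub_of_lnorm_comm gT G N (2 ^ k * M)%N _ _ k M 1%G) => //.
  - exact/char_normal/index_core_char.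
  - by move=> L; apply: index_core_min.
  - exact: normal1.
  rewrite (leq_trans leG) // leq_mul2l; apply/orP; right.
  by apply/subset_leq_card/subsetP => g; rewrite !inE.
have nilN : nilpotent N by apply/lcnP; exists k; apply/trivgP.
rewrite /nilpotent_class_lt nilN ltnS; apply/lcn_nil_classP => //; exact/trivgP.
Qed.

Theorem theorem1 (R : realType) (eps : R) (d k : nat)
    (eps_gt0 : (0 < eps)%R) (d_ge1 : (1 <= d)%N) (k_ge1 : (1 <= k)%N) :
  exists r : nat,
    forall (gT : finGroupType) (G : {group gT}),
      (eps <= Pr_lnorm_comm1 R G k)%R ->
      exists N : {group gT},
        [/\ N \char G,
            nilpotent_class_lt k N
          & forall H : {group coset_of N},
              H \subset G / N -> generated_by_d d H -> (#|H| <= r)%N].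
Proof.
case: k k_ge1 => // k _.
pose M := Num.bound eps^-1.
pose m := (2 ^ k * M)%N.
exists (m ^ (m.+1 ^ (d * m.+1) * m.+1))%N => gT G leP.
have M_gt : (eps^-1 < M%:R)%R.
  by apply: archi_boundP; rewrite invr_ge0 ltW.
have M_gt0 : 0 < M by rewrite -(ltr_nat R) (lt_trans _ M_gt) ?invr_gt0.
exists (index_core m G); split; first exact: index_core_char.
  apply: nilpotent_index_core.
  have G_gt0 : (0 < (#|G| ^ k.+1)%N%:R :> R)%R.
    by rewrite ltr0n expn_gt0 cardG_gt0.
  move: leP; rewrite /Pr_lnorm_comm1 ler_pdivlMr // mulrC -ler_pdivlMr // => leP.
  rewrite -(ler_nat R) natrM (le_trans leP) // mulrC.
  by rewrite ler_wpM2r ?ler0n // ltW.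
by move=> H; apply: card_quotient_index_core_le; rewrite muln_gt0 expn_gt0.
Qed.
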